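(* Let $(X,d)$ be a metric space, let $x_1,\dots,x_n \in X$ be points that are not all identical, and let $D \in \mathbb{R}^{n\times n}$ be the matrix given by $D_{ij} = d(x_i,x_j)$. Let $v = (v_1,\dots,v_n) \in \mathbb{R}^n_{\geq 0}$ be the Perron-Frobenius eigenvector of $D$, normalized to $\|v\| = 1$. Then $$\min_{1 \leq i \leq n} v_i \geq \frac{1}{2\sqrt{n}} \qquad \text{and} \qquad \langle v, \mathbb{1}\rangle \geq \frac{\sqrt{n}}{\sqrt{2}}.$$
   Context: The points $x_1,\dots,x_n$ are not required to be pairwise distinct. $\mathbb{1} = (1,\dots,1) \in \mathbb{R}^n$, $\langle\cdot,\cdot\rangle$ is the standard Euclidean inner product, and $\|\cdot\|$ is the Euclidean ($\ell^2$) norm on $\mathbb{R}^n$. The Perron-Frobenius eigenvector of $D$ is the eigenvector with nonnegative entries associated to the largest eigenvalue of $D$ (its existence is guaranteed by the Perron-Frobenius theorem, since $D$ has nonnegative entries). *)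

(* Defs.v *)
From HB Require Import structures.
From mathcomp Require Import all_boot all_order all_algebra.
From mathcomp Require Import all_classical all_reals all_analysis.

Set Implicit Arguments.
Unset Strict Implicit.
Unset Printing Implicit Defensive.

Import Order.TTheory GRing.Theory Num.Theory.

Local Open Scope ring_scope.

Definition distance_matrix (R : realType) (X : metricType R) (n : nat)
    (x : 'I_n -> X) : 'M[R]_n :=
  \matrix_(i, j) mdist (x i) (x j).

Definition dotv (R : realType) (n : nat) (u w : 'cV[R]_n) : R :=
  \sum_i u i 0 * w i 0.

(* The norm `|v| of mathcomp-analysis on matrices is the sup norm, hence this
   separate definition of the l2 norm. *)
Definition l2norm (R : realType) (n : nat) (v : 'cV[R]_n) : R :=
  Num.sqrt (dotv v v).

(* [eigenvalue] is defined through row eigenvectors; a square matrix and its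
   transpose have the same eigenvalues.  Only real eigenvalues are compared:
   for a symmetric matrix, such as a distance matrix, there are no others. *)
Definition largest_eigenvalue (R : realType) (n : nat) (A : 'M[R]_n)
    (lambda : R) : Prop :=
  eigenvalue A lambda /\ (forall mu : R, eigenvalue A mu -> mu <= lambda).

Definition perron_frobenius_eigenvector (R : realType) (n : nat)
    (A : 'M[R]_n) (v : 'cV[R]_n) : Prop :=
  [/\ v != 0,
      forall i, 0 <= v i 0
    & exists2 lambda : R, largest_eigenvalue A lambda & A *m v = lambda *: v].

(* Main.v *)
Require Import Defs.
From HB Require Import structures.
From mathcomp Require Import all_boot all_order all_algebra.
From mathcomp Require Import all_classical all_reals all_analysis.
From mathcomp Require Import ring lra.

Import Order.TTheory GRing.Theory Num.Theory.

Local Open Scope ring_scope.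

(** Write [S] for the sum of the entries of [v] and [D v = lambda v], where
    [lambda > 0].  Weighting the triangle inequality
    [d(x_i, x_j) <= d(x_i, x_k) + d(x_k, x_j)] by [v_j] and summing over [j]
    gives the Lipschitz bound [lambda v_i <= d(x_i, x_k) S + lambda v_k].
    Weighting it by [v_i] and summing over [i] gives [1 <= 2 S v_k], and
    summing this over [k] gives [n <= 2 S^2].  Since [S <= sqrt n] by
    Cauchy-Schwarz, both bounds follow. *)

Section DistanceMatrixEigenvector.
Context {R : realType} {X : metricType R} {n : nat}.
Variables (x : 'I_n -> X) (v : 'cV[R]_n) (lambda : R).
Hypothesis v_ge0 : forall i, 0 <= v i 0.
Hypothesis v_eigen : distance_matrix x *m v = lambda *: v.

Lemma eigen_sum_mdist (i : 'I_n) :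
  \sum_j mdist (x i) (x j) * v j 0 = lambda * v i 0.
Proof.
have /matrixP/(_ i 0) := v_eigen; rewrite !mxE => <-.
by apply: eq_bigr => j _; rewrite mxE.
Qed.

(** If [lambda <= 0], each row sum of the nonnegative terms d(x_i, x_k) v_k equals lambda v_i <= 0,
    so every term vanishes. At an index [j] with v_j nonzero this forces x_i = x_j for all i, so all
    points coincide. *)
Lemma eigenvalue_gt0 :
  v != 0 -> ~ (forall i j : 'I_n, x i = x j) -> 0 < lambda.
Proof.
move=> v_neq0 hx; rewrite ltNge; apply/negP => lambda_le0; apply: hx.
have [j vj_neq0] : exists j, v j 0 != 0.
  apply/existsP; apply: contraR v_neq0 => /existsPn v0.
  by apply/eqP/colP => j; rewrite mxE; apply/eqP/negbNE/v0.
suff x_j i : x i = x j by move=> i k; rewrite !x_j.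
have terms_ge0 k : true -> 0 <= mdist (x i) (x k) * v k 0.
  by rewrite mulr_ge0 ?mdist_ge0.
have sum0 : \sum_k mdist (x i) (x k) * v k 0 = 0.
  apply/eqP; rewrite eq_le sumr_ge0 // eigen_sum_mdist andbT.
  by rewrite mulr_le0_ge0.
have /(_ j isT) /eqP := psumr_eq0P terms_ge0 sum0.
by rewrite mulf_eq0 (negbTE vj_neq0) orbF => /eqP /mdist_positivity.
Qed.

Lemma eigenvector_lipschitz (i k : 'I_n) :
  lambda * v i 0 <= mdist (x i) (x k) * (\sum_j v j 0) + lambda * v k 0.
Proof.
rewrite -!eigen_sum_mdist mulr_sumr -big_split /=; apply: ler_sum => j _.
by rewrite -mulrDl ler_wpM2r // metric_triangle.
Qed.

Lemma eigenvector_entry_bound (k : 'I_n) : 0 < lambda ->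
  \sum_i v i 0 ^+ 2 <= 2 * (\sum_i v i 0) * v k 0.
Proof.
move=> lambda_gt0; rewrite -(ler_pM2l lambda_gt0) mulr_sumr.
(* Of the two copies of lambda S v_k, one is expanded by row [k] of the eigenvector equation and the
   other is kept. The comparison then holds term by term: it is the Lipschitz bound for (i, k)
   multiplied by v_i. *)
have -> : lambda * (2 * (\sum_i v i 0) * v k 0) =
    (\sum_i v i 0) * (\sum_i mdist (x k) (x i) * v i 0)
    + (\sum_i v i 0) * (lambda * v k 0).
  by rewrite eigen_sum_mdist; ring.
rewrite mulr_sumr [X in _ + X]mulr_suml -big_split /=.
apply: ler_sum => i _.
have := ler_wpM2r (v_ge0 i) (eigenvector_lipschitz i k).
by rewrite [mdist (x i) _]metric_sym; nra.
Qed.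

End DistanceMatrixEigenvector.

(** A variance argument: the squared deviations from the mean, scaled by n to avoid division, sum to
    n (n sum a_i^2 - S^2). Cancelling the outer n requires n > 0, hence the case split. *)
Lemma sum_sqr_le {R : realFieldType} {n : nat} (a : 'I_n -> R) :
  (\sum_i a i) ^+ 2 <= n%:R * \sum_i a i ^+ 2.
Proof.
case: n a => [|n] a; first by rewrite !big_ord0 expr0n mulr0.
set S := \sum_i a i; have n_gt0 : 0 < n.+1%:R :> R by rewrite ltr0Sn.
have : 0 <= \sum_i (n.+1%:R * a i - S) ^+ 2.
  by apply: sumr_ge0 => i _; rewrite sqr_ge0.
have -> : \sum_i (n.+1%:R * a i - S) ^+ 2 =
    n.+1%:R * (n.+1%:R * (\sum_i a i ^+ 2) - S ^+ 2).
  transitivity (\sum_i (n.+1%:R ^+ 2 * a i ^+ 2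
      - 2 * n.+1%:R * S * a i + S ^+ 2)); first by apply: eq_bigr => i _; ring.
  rewrite big_split /= sumr_const card_ord sumrB -!mulr_sumr -/S -mulr_natl.
  by ring.
by rewrite pmulr_rge0 // subr_ge0.
Qed.

Theorem mainTheorem1 (R : realType) (X : metricType R) (n : nat)
    (x : 'I_n -> X) (v : 'cV[R]_n)
    (hx : ~ (forall i j : 'I_n, x i = x j))
    (hv : perron_frobenius_eigenvector (distance_matrix x) v)
    (hnorm : l2norm v = 1) :
  (forall i : 'I_n, 1 / (2 * Num.sqrt n%:R) <= v i 0) /\
  Num.sqrt n%:R / Num.sqrt 2 <= dotv v (const_mx 1).
Proof.
case: hv => v_neq0 v_ge0 [lambda _ v_eigen].
have lambda_gt0 := eigenvalue_gt0 _ _ _ v_ge0 v_eigen v_neq0 hx.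
have norm1 : \sum_i v i 0 ^+ 2 = 1.
  have : dotv v v = 1.
    rewrite -[LHS]sqr_sqrtr; first by rewrite -/(l2norm v) hnorm expr1n.
    by apply: sumr_ge0 => i _; rewrite mulr_ge0.
  by move=> <-; apply: eq_bigr.
have -> : dotv v (const_mx 1) = \sum_i v i 0.
  by apply: eq_bigr => i _; rewrite mxE mulr1.
have entry k := eigenvector_entry_bound _ _ _ v_ge0 v_eigen k lambda_gt0.
have := sum_sqr_le (fun i => v i 0); rewrite norm1 mulr1 in entry *.
set S := \sum_i v i 0 in entry *; move=> S_sqr_le.
have S_ge0 : 0 <= S by apply: sumr_ge0.
(* With no indices all points would agree vacuously, contradicting [hx]. *)
have n_gt0 : 0 < n%:R :> R.
  by rewrite ltr0n lt0n; apply/eqP => n0; apply: hx => i; have := ltn_ord i; rewrite {2}n0.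
have sqrtn_gt0 : 0 < Num.sqrt n%:R :> R by rewrite sqrtr_gt0.
split=> [k|].
  have S_le : S <= Num.sqrt n%:R.
    by rewrite -[S]ger0_norm // -sqrtr_sqr ler_wsqrtr.
  rewrite ler_pdivrMr ?mulr_gt0 //; apply: le_trans (entry k) _.
  by rewrite [leRHS]mulrC ler_wpM2r // ler_wpM2l.
have n_le : n%:R <= S ^+ 2 * 2.
  have -> : S ^+ 2 * 2 = \sum_k 2 * S * v k 0.
    by rewrite -mulr_sumr -/S; ring.
  by rewrite -[n in n%:R]card_ord -sumr_const ler_sum.
(* Writing S as the root of S^2 turns the goal into sqrt n <= sqrt (2 S^2), which is [n_le] under
   the monotone square root. *)
rewrite ler_pdivrMr ?sqrtr_gt0 // -[S]ger0_norm // -sqrtr_sqr.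
by rewrite -sqrtrM ?sqr_ge0 // ler_wsqrtr.
Qed.
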